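(* Let $M$ be an F-inverse Clifford monoid and define $f \colon M/\sigma \to E(M)$ by $f(g) = s(g)s(g)^{-1}$, where $s(g)$ is the largest element in the $\sigma$-class $g$. Then $\mathrm{Gl}(f) \simeq M$ (isomorphism of monoids).
   Context: A monoid $M$ is inverse if for each $x \in M$ there is a unique $x^{-1} \in M$ with $xx^{-1}x = x$ and $x^{-1}xx^{-1} = x^{-1}$. Its set of idempotents $E(M)$ is a semilattice under multiplication (written $\wedge$). The natural order on $M$ is: $x \le y$ if there exists $e \in E(M)$ with $x = ey$. The congruence $\sigma$ is the smallest congruence on $M$ such that $M/\sigma$ is a group. An inverse monoid is F-inverse if each $\sigma$-class has a largest element in the natural order. An inverse monoid is Clifford if its idempotents are central. For a group $G$, a semilattice $Y$ and a function $f \colon G \to Y$ satisfying $f(gh) \wedge f(g) = f(g) \wedge f(h)$ for all $g,h \in G$, the gluing of $f$ is $\mathrm{Gl}(f) = \{(y,g) \in Y \times G : y \le f(g)\}$ with multiplication $(y,g)(z,h) = (y \wedge z, gh)$. (The function $f$ in the claim satisfies this identity, with $G = M/\sigma$ and $Y = E(M)$.) *)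

(* Defs.v *)
From HB Require Import structures.
From mathcomp Require Import all_boot all_order.
From mathcomp Require Import boolp.
Set Implicit Arguments.
Unset Strict Implicit.
Unset Printing Implicit Defensive.
Import Algebra Order.LTheory.
Local Open Scope group_scope.

HB.mixin Record isInverseMonoid M of Monoid M := {
  unique_inverse :
    forall x : M, exists! y : M, x * y * x = x /\ y * x * y = y
}.

#[short(type="inverseMonoidType")]
HB.structure Definition InverseMonoid := { M of isInverseMonoid M & Monoid M }.

Definition invm (M : inverseMonoidType) (x : M) : M :=
  sval (cid (unique_inverse x)).
Local Notation "x ^-1" := (invm x) : group_scope.

Lemma mulgVKg (M : inverseMonoidType) (x : M) : x * x^-1 * x = x.
Proof. by rewrite /invm; case: cid => y [[]]. Qed.

Lemma mulVgKV (M : inverseMonoidType) (x : M) : x^-1 * x * x^-1 = x^-1.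
Proof. by rewrite /invm; case: cid => y [[]]. Qed.

Lemma invm_uniq (M : inverseMonoidType) (x y : M) :
  x * y * x = x -> y * x * y = y -> y = x^-1.
Proof. by rewrite /invm; case: cid => z [_ uz] /= h1 h2; apply/esym/uz. Qed.

Lemma invm_idem (M : inverseMonoidType) (e : M) : e * e = e -> e^-1 = e.
Proof. by move=> ee; apply/esym/invm_uniq; rewrite !ee. Qed.

Lemma invmK (M : inverseMonoidType) (x : M) : x^-1^-1 = x.
Proof. by apply/esym/invm_uniq; rewrite ?mulgVKg ?mulVgKV. Qed.

Lemma mulgV_idem (M : inverseMonoidType) (x : M) :
  (x * x^-1) * (x * x^-1) = x * x^-1.
Proof. by rewrite mulgA mulgVKg. Qed.

Lemma mulVg_idem (M : inverseMonoidType) (x : M) :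
  (x^-1 * x) * (x^-1 * x) = x^-1 * x.
Proof. by rewrite mulgA mulVgKV. Qed.

Section IdempotentsCommute.
Variable M : inverseMonoidType.
Implicit Types e f : M.

Let idem_mul_sub e f : e * e = e -> f * f = f ->
  (e * f) * (e * f) = e * f.
Proof.
move=> ee ff; set x := (e * f)^-1.
have h1 : e * (f * (x * (e * f))) = e * f.
  by have := mulgVKg (e * f); rewrite -/x !mulgA.
have h2 : x * (e * (f * x)) = x.
  by have := mulVgKV (e * f); rewrite -/x !mulgA.
have xE : f * x * e = x.
  apply: invm_uniq; rewrite -!mulgA.
    by rewrite (mulgA f f) ff (mulgA e e) ee h1.
  rewrite (mulgA e e) ee (mulgA f f) ff.
  by congr (f * _); rewrite -{3}h2 -!mulgA.
have xx : x * x = x.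
  rewrite -{1 2}xE -[RHS]xE -!mulgA; congr (f * _).
  by rewrite -{3}h2 -!mulgA.
have efE : e * f = x by rewrite -(invmK (e * f)) -/x invm_idem.
by rewrite efE xx.
Qed.

Lemma idem_mulC e f : e * e = e -> f * f = f -> e * f = f * e.
Proof.
move=> ee ff; rewrite -[LHS]invm_idem; last exact: idem_mul_sub.
apply/esym/invm_uniq.
  rewrite -!mulgA (mulgA f f) ff (mulgA e e) ee.
  by have := idem_mul_sub ee ff; rewrite -!mulgA.
rewrite -!mulgA (mulgA e e) ee (mulgA f f) ff.
by have := idem_mul_sub ff ee; rewrite -!mulgA.
Qed.

Lemma idem_mul e f : e * e = e -> f * f = f -> (e * f) * (e * f) = e * f.
Proof. exact: idem_mul_sub. Qed.

End IdempotentsCommute.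

Definition idem (M : inverseMonoidType) : Type := {e : M | e * e == e}.

Fact idem_display : Order.disp_t. Proof. exact: (Order.Disp tt tt). Qed.

Section IdempotentSemilattice.
Variable M : inverseMonoidType.

HB.instance Definition _ := [isSub of idem M for @sval M (fun e => e * e == e)].
HB.instance Definition _ := [Choice of idem M by <:].

Lemma idemP (e : idem M) : val e * val e = val e.
Proof. exact/eqP/(valP e). Qed.

Definition mk_idem (x : M) (xx : x * x = x) : idem M :=
  exist _ x (introT eqP xx).

Definition idem_meet (e f : idem M) : idem M :=
  mk_idem (idem_mul (idemP e) (idemP f)).
Definition idem_le (e f : idem M) : bool := idem_meet e f == e.
Definition idem_lt (e f : idem M) : bool := (f != e) && idem_le e f.

Lemma idem_meetC : commutative idem_meet.
Proof. by move=> e f; apply: val_inj; rewrite /= idem_mulC ?idemP. Qed.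

Lemma idem_meetA : associative idem_meet.
Proof. by move=> e f g; apply: val_inj; rewrite /= mulgA. Qed.

Lemma idem_meetxx e : idem_meet e e = e.
Proof. by apply: val_inj; rewrite /= idemP. Qed.

Lemma idem_le_refl : reflexive idem_le.
Proof. by move=> e; rewrite /idem_le idem_meetxx. Qed.

Lemma idem_le_anti : antisymmetric idem_le.
Proof. by move=> e f /andP[/eqP ef /eqP fe]; rewrite -ef idem_meetC fe. Qed.

Lemma idem_le_trans : transitive idem_le.
Proof.
by move=> f e g /eqP ef /eqP fg; rewrite /idem_le -ef -idem_meetA fg.
Qed.

HB.instance Definition _ := Order.isPOrder.Build idem_display (idem M)
  (fun _ _ => erefl) idem_le_refl idem_le_anti idem_le_trans.
HB.instance Definition _ :=
  Order.POrder_Meet_isSemilattice.Build idem_display (idem M)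
    idem_meetC idem_meetA (fun _ _ => erefl).

End IdempotentSemilattice.

Definition natural_le (M : inverseMonoidType) (x y : M) : Prop :=
  exists e : idem M, x = val e * y.

Lemma idem_leE (M : inverseMonoidType) (e f : idem M) :
  (e <= f)%O <-> natural_le (val e) (val f).
Proof.
split=> [/eqP ef | [g efE]]; first by exists e; rewrite -{1}ef.
by apply/eqP/val_inj; rewrite /= efE -mulgA idemP.
Qed.

Definition clifford (M : inverseMonoidType) : Prop :=
  forall (e : idem M) (x : M), val e * x = x * val e.

Section Congruence.
Local Open Scope quotient_scope.

Record congruence (M : monoidType) := Congruence {
  cong_rel :> equiv_rel M;
  congM : forall x x' y y' : M,
    cong_rel x x' -> cong_rel y y' -> cong_rel (x * y) (x' * y')
}.

Definition mquot (M : monoidType) (R : congruence M) : Type := {eq_quot R}.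

Section QuotientMonoid.
Variables (M : monoidType) (R : congruence M).

HB.instance Definition _ := Choice.on (mquot R).
HB.instance Definition _ := EqQuotient.on (mquot R).

Definition mclass (x : M) : mquot R := \pi x.

Lemma mclassP (x y : M) : reflect (mclass x = mclass y) (R x y).
Proof. exact: eqquotP. Qed.

Lemma mclassK (a : mquot R) : mclass (repr a) = a.
Proof. exact: reprK. Qed.

Definition mquot_mul (a b : mquot R) : mquot R := mclass (repr a * repr b).
Definition mquot_one : mquot R := mclass 1.

Lemma mclass_mul (x y : M) : mquot_mul (mclass x) (mclass y) = mclass (x * y).
Proof. by apply/mclassP; apply: congM; apply/mclassP; apply: mclassK. Qed.

Lemma mquot_mulA : associative mquot_mul.
Proof.
move=> a b c.
by rewrite -(mclassK a) -(mclassK b) -(mclassK c) !mclass_mul mulgA.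
Qed.

Lemma mquot_mul1 : left_id mquot_one mquot_mul.
Proof. by move=> a; rewrite -(mclassK a) mclass_mul mul1g. Qed.

Lemma mquot_mulr1 : right_id mquot_one mquot_mul.
Proof. by move=> a; rewrite -(mclassK a) mclass_mul mulg1. Qed.

HB.instance Definition _ :=
  isMonoid.Build (mquot R) mquot_mulA mquot_mul1 mquot_mulr1.

Lemma mclassM (x y : M) : mclass (x * y) = mclass x * mclass y.
Proof. by rewrite -mclass_mul. Qed.

End QuotientMonoid.

Definition is_group (N : monoidType) : Prop :=
  forall a : N, exists b : N, b * a = 1 /\ a * b = 1.

Section Sigma.
Variable M : inverseMonoidType.

(* The intersection of all group congruences; that its quotient is again a group
   is sigma_is_group, so that sigma is the least group congruence. Congruences
   are boolean-valued, which under boolp's axioms is no restriction. *)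
Definition sigma_rel : rel M := fun x y =>
  `[< forall R : congruence M, is_group (mquot R) -> R x y >].

Lemma sigma_refl : reflexive sigma_rel.
Proof. by move=> x; apply/asboolP => R _; apply: equiv_refl. Qed.

Lemma sigma_sym : symmetric sigma_rel.
Proof.
by move=> x y; apply/asboolP/asboolP => h R gR; rewrite equiv_sym; apply: h.
Qed.

Lemma sigma_trans : transitive sigma_rel.
Proof.
move=> y x z /asboolP xy /asboolP yz; apply/asboolP => R gR.
exact: equiv_trans (xy R gR) (yz R gR).
Qed.

Lemma sigmaM (x x' y y' : M) :
  sigma_rel x x' -> sigma_rel y y' -> sigma_rel (x * y) (x' * y').
Proof.
move=> /asboolP hx /asboolP hy; apply/asboolP => R gR.
by apply: congM; [apply: hx | apply: hy].
Qed.

Definition sigma : congruence M :=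
  @Congruence M (EquivRel sigma_rel sigma_refl sigma_sym sigma_trans) sigmaM.

Lemma sigma_min (R : congruence M) (x y : M) :
  is_group (mquot R) -> sigma x y -> R x y.
Proof. by move=> gR /asboolP; apply. Qed.

Lemma sigma_idem (e : M) : e * e = e -> sigma e 1.
Proof.
move=> ee; apply/asboolP => R gR; apply/mclassP.
have [b [be _]] := gR (mclass R e).
by rewrite -[LHS]mul1g -be -mulgA -mclassM ee be.
Qed.

Definition sigma_quot : Type := mquot sigma.
HB.instance Definition _ := Monoid.on sigma_quot.
HB.instance Definition _ := EqQuotient.on sigma_quot.

Definition sigma_class (x : M) : sigma_quot := mclass sigma x.

Definition sigma_inv (a : sigma_quot) : sigma_quot := sigma_class ((repr a)^-1).
HB.instance Definition _ := hasInv.Build sigma_quot sigma_inv.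

Lemma sigma_mulVg : left_inverse 1 sigma_inv (@mul sigma_quot).
Proof.
move=> a; rewrite -{2}(mclassK a) -[LHS]mclassM.
exact/mclassP/sigma_idem/mulVg_idem.
Qed.

Lemma sigma_mulgV : right_inverse 1 sigma_inv (@mul sigma_quot).
Proof.
move=> a; rewrite -{1}(mclassK a) -[LHS]mclassM.
exact/mclassP/sigma_idem/mulgV_idem.
Qed.

HB.instance Definition _ := Monoid_isGroup.Build sigma_quot sigma_mulVg sigma_mulgV.

Lemma sigma_is_group : is_group (mquot sigma).
Proof.
by move=> a; exists (sigma_inv a); rewrite sigma_mulVg sigma_mulgV.
Qed.

Definition is_greatest_in_class (g : sigma_quot) (m : M) : Prop :=
  sigma_class m = g /\
  forall x : M, sigma_class x = g -> natural_le x m.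

Definition F_inverse : Prop :=
  forall g : sigma_quot, exists m : M, is_greatest_in_class g m.

Definition max_elt (HF : F_inverse) (g : sigma_quot) : M := sval (cid (HF g)).

Lemma max_eltP (HF : F_inverse) (g : sigma_quot) :
  is_greatest_in_class g (max_elt HF g).
Proof. exact: svalP (cid (HF g)). Qed.

Definition max_idem (HF : F_inverse) (g : sigma_quot) : idem M :=
  mk_idem (mulgV_idem (max_elt HF g)).

End Sigma.
End Congruence.

Section Gluing.
Context {d : Order.disp_t} {G : groupType} {Y : meetSemilatticeType d}.
Local Open Scope order_scope.

Definition gluing_identity (f : G -> Y) : Prop :=
  forall g h : G, f (g * h)%g `&` f g = f g `&` f h.

Definition Gl (f : G -> Y) (hf : gluing_identity f) : Type :=
  {p : Y * G | p.1 <= f p.2}.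

Variables (f : G -> Y) (hf : gluing_identity f).

HB.instance Definition _ :=
  [isSub of Gl hf for @sval (Y * G)%type (fun p => p.1 <= f p.2)].
HB.instance Definition _ := [Choice of Gl hf by <:].

Lemma Gl_mul_proof (p q : Gl hf) :
  (val p).1 `&` (val q).1 <= f ((val p).2 * (val q).2)%g.
Proof.
apply: le_trans (leI2 (valP p) (valP q)) _.
by rewrite -hf leIl.
Qed.

Definition Gl_mul (p q : Gl hf) : Gl hf :=
  Sub ((val p).1 `&` (val q).1, ((val p).2 * (val q).2)%g) (Gl_mul_proof p q).

(* The unit is (f 1, 1): Y need not have a top, but the identity at h = 1 says
   that f 1 bounds the image of f. *)
Definition Gl_one : Gl hf := Sub (f 1%g, 1%g) (lexx (f 1%g)).

Lemma gluing_le1 (g : G) : f g <= f 1%g.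
Proof. by have := hf g 1%g; rewrite mulg1 meetxx => ->; apply: leIr. Qed.

Lemma Gl_mulA : associative Gl_mul.
Proof. by move=> p q r; apply: val_inj; rewrite /= meetA mulgA. Qed.

Lemma Gl_mul1 : left_id Gl_one Gl_mul.
Proof.
move=> p; apply: val_inj; rewrite /= mul1g meet_r -?surjective_pairing //.
exact: le_trans (valP p) (gluing_le1 _).
Qed.

Lemma Gl_mulr1 : right_id Gl_one Gl_mul.
Proof.
move=> p; apply: val_inj; rewrite /= mulg1 meet_l -?surjective_pairing //.
exact: le_trans (valP p) (gluing_le1 _).
Qed.

HB.instance Definition _ := isMonoid.Build (Gl hf) Gl_mulA Gl_mul1 Gl_mulr1.

End Gluing.

Definition monoid_isomorphic (M N : monoidType) : Prop :=
  exists phi : M -> N, monoid_morphism phi /\ bijective phi.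

(* Main.v *)
Require Import Defs.
From mathcomp Require Import all_boot all_order.

(** In a Clifford inverse monoid, [x |-> x x^-1] is a monoid homomorphism [dom]
    onto the idempotents ([domM]): centrality lets [y y^-1] slide out of
    [x (y y^-1) x^-1].  In an F-inverse monoid, [x] is recovered from the pair
    ([dom x], class of [x]): writing [s g] for the greatest element of the class
    [g], [x] lies below [s [x]], and whatever lies below [m] is the restriction
    of [m] to its own domain, so [x = dom x * s [x]] ([dom_max_elt]).

    Hence [(y, g) |-> y * s g] and [x |-> (dom x, [x])] are mutually inverse:
    the condition [y <= f g = dom (s g)] is what makes [dom (y * s g) = y].
    Multiplicativity amounts to [s g * s h = f g * f h * s (g h)], which is the
    same reconstruction formula applied to [s g * s h].

    The gluing identity expresses that [dom x <= f [x]] for every [x]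
    ([dom_le_max_idem]): with [x = s g * s h] it bounds [f g /\ f h] by
    [f (g h)], and with [x = (s g)^-1 * s (g h)], which lies in the class [h],
    it bounds [f (g h) /\ f g] by [f h]. *)

Set Implicit Arguments.
Unset Strict Implicit.
Unset Printing Implicit Defensive.
Import Algebra Order.LTheory.
Local Open Scope group_scope.
Local Notation "x ^-1" := (invm x) : group_scope.

Definition dom (M : inverseMonoidType) (x : M) : idem M :=
  mk_idem (mulgV_idem x).

Section InverseMonoid.
Variable M : inverseMonoidType.
Implicit Types (x y : M) (e : idem M).

Lemma dom_mul x : val (dom x) * x = x.
Proof. exact: mulgVKg. Qed.

Lemma dom_idem e : dom (val e) = e.
Proof. by apply: val_inj; rewrite /= invm_idem idemP. Qed.

Lemma sigma_class_idem e : sigma_class (val e) = 1.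
Proof. exact/mclassP/sigma_idem/idemP. Qed.

Lemma sigma_classM x y : sigma_class (x * y) = sigma_class x * sigma_class y.
Proof. exact: mclassM. Qed.

End InverseMonoid.

Section Clifford.
Variables (M : inverseMonoidType) (HC : clifford M).
Implicit Types (x y : M) (e : idem M).

Lemma mulgV_central x y : x * x^-1 * y = y * (x * x^-1).
Proof. exact: HC (dom x) y. Qed.

(** Sliding the central idempotent [x x^-1] to the front of
    [x^-1 (x x^-1) x] gives [x^-1 x <= x x^-1], and symmetrically. *)
Lemma mulVg_mulgV x : x^-1 * x = x * x^-1.
Proof.
have mulVg_mulgV_idem (y : M) : y^-1 * y = (y * y^-1) * (y^-1 * y).
  by rewrite (mulgA (y * y^-1)) mulgV_central !mulgA mulVgKV.
have mulgV_mulVg_idem := mulVg_mulgV_idem x^-1.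
rewrite invmK in mulgV_mulVg_idem.
rewrite mulVg_mulgV_idem mulgV_mulVg_idem.
rewrite (idem_mulC (mulVg_idem x) (mulgV_idem x)).
by rewrite -mulgA mulVg_idem.
Qed.

Lemma dom_inv x : dom x^-1 = dom x.
Proof. by apply: val_inj; rewrite /= invmK mulVg_mulgV. Qed.

Lemma invm_mul x y : (x * y)^-1 = y^-1 * x^-1.
Proof.
have mul_regular (a b : M) : a * b * (b^-1 * a^-1) * (a * b) = a * b.
  have -> : a * b * (b^-1 * a^-1) * (a * b)
          = a * (b * b^-1) * a^-1 * a * b by rewrite !mulgA.
  by rewrite -mulgV_central -!(mulgA (b * b^-1)) mulgVKg mulgA mulgV_central
             -mulgA mulgVKg.
apply/esym/invm_uniq; first exact: mul_regular.
by have := mul_regular y^-1 x^-1; rewrite !invmK.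
Qed.

Lemma domM x y : dom (x * y) = (dom x `&` dom y)%O.
Proof.
apply: val_inj; rewrite /= invm_mul.
have -> : x * y * (y^-1 * x^-1) = x * (y * y^-1) * x^-1 by rewrite !mulgA.
by rewrite -mulgV_central -mulgA mulgV_central.
Qed.

(** If [x = e y] then [dom x = e /\ dom y], and [dom y] fixes [y], so [e] may be
    replaced by [dom x]. *)
Lemma natural_leE x y : natural_le x y -> x = val (dom x) * y.
Proof.
case=> e xE; rewrite {2}xE domM dom_idem.
by rewrite [val _]/= -mulgA dom_mul.
Qed.

Lemma dom_le x y : natural_le x y -> (dom x <= dom y)%O.
Proof. by move=> [e ->]; rewrite domM leIr. Qed.

Section FInverse.
Variable HF : F_inverse M.

Lemma sigma_class_max_elt g : sigma_class (max_elt HF g) = g.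
Proof. by case: (max_eltP HF g). Qed.

Lemma le_max_elt x : natural_le x (max_elt HF (sigma_class x)).
Proof. by case: (max_eltP HF (sigma_class x)) => _; apply. Qed.

(** Reconstruction of an element from its domain and its class, on which the
    bijection with the gluing rests. *)
Lemma dom_max_elt x : val (dom x) * max_elt HF (sigma_class x) = x.
Proof. exact/esym/natural_leE/le_max_elt. Qed.

(** Among the elements of a class, the greatest has the greatest domain; this is
    what the gluing identity comes from, and what makes [to_gluing] land in
    [Gl f]. *)
Lemma dom_le_max_idem x : (dom x <= max_idem HF (sigma_class x))%O.
Proof. exact: dom_le (le_max_elt x). Qed.

(** [dom 1 = 1], so reconstructing [1] leaves the greatest element of its class
    unchanged. *)
Lemma max_elt1 : max_elt HF 1 = 1.
Proof.
have := dom_max_elt 1.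
by rewrite [val _]/= invm_idem ?mul1g.
Qed.

Lemma sigma_class_max_eltM g h :
  sigma_class (max_elt HF g * max_elt HF h) = g * h.
Proof. by rewrite sigma_classM !sigma_class_max_elt. Qed.

(** The product lies in the class [g h] and has domain [f g /\ f h], so it is
    reconstructed from these. *)
Lemma max_eltM g h :
  max_elt HF g * max_elt HF h
  = val (max_idem HF g `&` max_idem HF h)%O * max_elt HF (g * h).
Proof. by rewrite -[LHS]dom_max_elt domM sigma_class_max_eltM. Qed.

(** Both inequalities bound the domain of an element by that of the greatest
    element of its class.  The element [(s g)^-1 * s (g h)] has domain
    [f g /\ f (g h)] because inversion preserves domains. *)
Lemma max_idem_gluing : gluing_identity (max_idem HF).
Proof.
move=> g h; set s := max_elt HF; apply/le_anti/andP; split.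
  rewrite lexI leIr /=.
  have s_class : sigma_class ((s g)^-1 * s (g * h)) = h.
    rewrite sigma_classM sigma_class_max_elt.
    rewrite -[in g * h](sigma_class_max_elt g) mulgA -sigma_classM mulVg_mulgV.
    by rewrite (sigma_class_idem (dom _)) mul1g.
  have := dom_le_max_idem ((s g)^-1 * s (g * h)).
  by rewrite s_class domM dom_inv meetC.
rewrite lexI leIl andbT.
by have := dom_le_max_idem (s g * s h); rewrite domM sigma_class_max_eltM.
Qed.

Definition of_gluing (p : Gl max_idem_gluing) : M :=
  val (val p).1 * max_elt HF (val p).2.

Definition to_gluing (x : M) : Gl max_idem_gluing :=
  Sub (dom x, sigma_class x) (dom_le_max_idem x).

Lemma to_gluingK : cancel to_gluing of_gluing.
Proof. exact: dom_max_elt. Qed.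

Lemma of_gluingK : cancel of_gluing to_gluing.
Proof.
move=> [[y g] /= y_le]; apply: val_inj; rewrite /of_gluing /=.
rewrite domM dom_idem (meet_l y_le).
by rewrite sigma_classM sigma_class_idem mul1g sigma_class_max_elt.
Qed.

Lemma of_gluing_morphism : monoid_morphism of_gluing.
Proof.
split=> [|[[y g] /= y_le] [[z h] /= z_le]]; rewrite /of_gluing /=.
  by rewrite max_elt1 invm_idem ?mul1g.
(* The extra factor [f g /\ f h] of [max_eltM] is absorbed by [y /\ z]. *)
have yz_le : ((y `&` z) `&` (max_idem HF g `&` max_idem HF h) = y `&` z)%O.
  by apply: meet_l; apply: leI2.
rewrite -[sval y * sval z]/(val (y `&` z)%O) -yz_le.
have -> : sval y * max_elt HF g * (sval z * max_elt HF h)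
        = sval y * sval z * (max_elt HF g * max_elt HF h).
  by rewrite -!mulgA (mulgA (max_elt HF g)) -(HC z) !mulgA.
by rewrite max_eltM mulgA.
Qed.

End FInverse.
End Clifford.

Theorem theorem2p14 (M : inverseMonoidType)
    (HF : F_inverse M) (HC : clifford M) :
  exists hf : gluing_identity (max_idem HF),
    monoid_isomorphic (Gl hf) M.
Proof.
exists (max_idem_gluing HC HF), (@of_gluing M HC HF); split.
  exact: of_gluing_morphism.
by exists (@to_gluing M HC HF); [apply: of_gluingK | apply: to_gluingK].
Qed.
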